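(* Let $G$ be a finite simple graph that is 3-regular and is a circle graph. Then $G$ has at least two disjoint pairs of twin vertices; that is, there exist four distinct vertices $v_1,v_2,w_1,w_2$ of $G$ such that $\{v_1,v_2\}$ is a pair of twins and $\{w_1,w_2\}$ is a pair of twins.
   Context: A double occurrence word is a finite sequence $w_1\dots w_{2n}$ in which $n$ distinct letters appear, each exactly twice. Its interlacement graph $\mathcal{I}(W)$ is the simple graph whose vertices are the $n$ letters, with two letters $a,b$ adjacent iff they appear in $W$ in the (not necessarily consecutive) order $abab$ or $baba$. A simple graph is a circle graph if it is isomorphic to the interlacement graph of some double occurrence word. Two distinct vertices $v_1,v_2$ of a simple graph are twins if they have the same neighbors outside $\{v_1,v_2\}$, i.e. $N(v_1)\setminus\{v_2\}=N(v_2)\setminus\{v_1\}$, where $N(v)$ is the open neighborhood of $v$. They are adjacent twins if moreover $v_1v_2$ is an edge, nonadjacent twins otherwise. *)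

(* Defs.v *)
From mathcomp Require Import all_boot.
Set Implicit Arguments. Unset Strict Implicit. Unset Printing Implicit Defensive.

Definition simple_graph (T : finType) (e : rel T) : Prop :=
  symmetric e /\ irreflexive e.

Definition double_occurrence (W : seq nat) : bool :=
  all (fun x => count_mem x W == 2) W.

Definition interlaced (W : seq nat) (a b : nat) : bool :=
  (a != b) &&
  (let s := [seq x <- W | (x == a) || (x == b)] in
   (s == [:: a; b; a; b]) || (s == [:: b; a; b; a])).

Definition circle_graph (T : finType) (e : rel T) : Prop :=
  exists (W : seq nat) (f : T -> nat),
    [/\ double_occurrence W,
        injective f,
        (forall x : T, f x \in W),
        (forall a, a \in W -> exists x : T, f x = a) &
        (forall x y : T, e x y = interlaced W (f x) (f y))].

Definition cubic (T : finType) (e : rel T) : Prop :=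
  forall v : T, #|[set w | e v w]| = 3.

Definition twins (T : finType) (e : rel T) (v1 v2 : T) : Prop :=
  v1 != v2 /\
  (forall u : T, u != v1 -> u != v2 -> e v1 u = e v2 u).

(* Main.v *)
Require Import Defs.
From mathcomp Require Import all_boot.
From mathcomp Require Import zify.
Set Implicit Arguments. Unset Strict Implicit. Unset Printing Implicit Defensive.

(* Fix a letter h, rotate the word so that it ends with h, and look for a pair
   of twins avoiding h; in the induction h may have degree less than 3, all
   other letters have degree 3.  Take a factor U, lying between the two
   occurrences of a letter p <> h or equal to the whole word without its last
   letter, that contains both ends of some letter and is minimal for inclusion.
   By minimality the two ends of a letter inside U are exactly 4 apart, and at
   most 3 letters occur once in U.  If two consecutive positions both start such
   a letter, the word contains a b s t a b, and a, b are twins.  If the word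
   contains a s t u a with s, t, u occurring once in U, then a and p are twins.
   Otherwise U = a s b t a q b.  Then the neighbors of t are p, a, b, so that,
   up to reversal, the word reads p U p Q1 q Q2 t with no letter linking Q1 or
   Q2 to the rest except the third neighbor w of q, which has one end in each.
   One of Q1 w, Q2 w is a smaller instance.

   Twin pairs avoiding each vertex in turn yield two disjoint twin pairs, or
   three pairwise twins; in the latter case the component is K_4 or K_{3,3}. *)

(** * Counting the occurrences of a letter *)

Definition occ (x : nat) (s : seq nat) : nat := count_mem x s.
Arguments occ : simpl never.

Lemma occ_nil x : occ x [::] = 0.
Proof. by []. Qed.

Lemma occ_cons x y s : occ x (y :: s) = (y == x) + occ x s.
Proof. by []. Qed.

Lemma occ_cat x s1 s2 : occ x (s1 ++ s2) = occ x s1 + occ x s2.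
Proof. exact: count_cat. Qed.

Definition occE := (occ_cat, occ_cons, occ_nil).

Lemma mem_occ x s : (x \in s) = (0 < occ x s).
Proof. by rewrite -has_pred1 has_count. Qed.

Lemma occ_double W x : double_occurrence W -> occ x W = 2 * (x \in W).
Proof.
move=> /allP dW; case: (boolP (x \in W)) => [/dW/eqP // | xW].
exact/count_memPn.
Qed.

Lemma occ_double_leq W x : double_occurrence W -> occ x W <= 2.
Proof. by move=> /occ_double->; case: (x \in W). Qed.

(** * Interlacement: symmetry, betweenness, reversal and rotation *)

Lemma interlacedC W a b : interlaced W a b = interlaced W b a.
Proof.
rewrite /interlaced eq_sym orbC; congr (_ && _).
by under eq_filter do rewrite orbC.
Qed.

Lemma interlaced_mem W a b : interlaced W a b -> b \in W.
Proof.
case/andP=> _ /orP E.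
have : b \in [seq x <- W | (x == a) || (x == b)].
  by case: E => /eqP ->; rewrite !inE eqxx ?orbT.
by rewrite mem_filter => /andP[].
Qed.

(** Restricted to [a] and [b] the word reads [b^i a b^j a b^k] with [i + j + k] equal to 0 or 2, and
    this alternates exactly when [j = 1]. *)
Lemma interlaced_between A B C a b : double_occurrence (A ++ a :: B ++ a :: C) ->
  interlaced (A ++ a :: B ++ a :: C) a b = (a != b) && (occ b B == 1).
Proof.
move=> dW; rewrite /interlaced; case: (eqVneq a b) => //= ab.
have ca := occ_double_leq a dW; have cb := occ_double b dW.
rewrite !occE eqxx in ca; rewrite !occE (negbTE ab) /= in cb.
have [aA aB aC] : [/\ occ a A = 0, occ a B = 0 & occ a C = 0] by split; lia.
have eqF s : occ a s = 0 ->
    [seq x <- s | (x == a) || (x == b)] = nseq (occ b s) b.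
  elim: s => //= x s IHs; rewrite !occ_cons; case: (eqVneq x a) => //= _ /IHs ->.
  by case: (eqVneq x b) => [->|].
rewrite !filter_cat /= !filter_cat /= eqxx !eqF //.
have : occ b A + occ b B + occ b C = 0 \/ occ b A + occ b B + occ b C = 2.
  by case: (b \in _) cb; lia.
clear -ab; move: (occ b A) (occ b B) (occ b C) => [|[|[|i]]] [|[|[|j]]] [|[|[|k]]];
  try (by case); move=> _ /=;
  by rewrite /eq_op /= ?eqxx ?(negbTE ab) ?(eq_sym b a) ?(negbTE ab) ?andbF.
Qed.

Lemma interlaced_rev W a b : interlaced (rev W) a b = interlaced W a b.
Proof.
by rewrite /interlaced filter_rev !(can2_eq (@revK _) (@revK _)) /rev /= orbC.
Qed.

(** Rotating [abab] by one letter gives [baba], and a letter other than [a] and [b] is filtered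
    out. *)
Lemma interlaced_rcons W c a b : interlaced (rcons W c) a b = interlaced (c :: W) a b.
Proof.
rewrite /interlaced filter_rcons /=; case: eqVneq => //= ab.
case: ifP => //; set s := filter _ _.
by case/orP => /eqP ->; case: s => [|x [|y [|z [|t s]]]] //=;
  rewrite ?eqseq_cons ?eqxx ?(eq_sym b a) ?(negbTE ab) //= ?andbF ?andbT ?orbF //;
  case: s => [|? ?] /=; rewrite ?eqseq_cons ?andbF.
Qed.

Lemma interlaced_catC A B a b : interlaced (A ++ B) a b = interlaced (B ++ A) a b.
Proof.
elim: A B => [|x A IHA] B; first by rewrite cats0.
by rewrite cat_cons -interlaced_rcons rcons_cat IHA cat_rcons.
Qed.

(** * Neighborhoods and twins among letters *)

Definition neighbors W a := [seq b <- undup W | interlaced W a b].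

Lemma mem_neighbors W a b : (b \in neighbors W a) = interlaced W a b.
Proof.
rewrite mem_filter mem_undup; apply/andb_idr; exact: interlaced_mem.
Qed.

Lemma uniq_neighbors W a : uniq (neighbors W a).
Proof. by rewrite filter_uniq ?undup_uniq. Qed.

Lemma leq_size_neighbors W a s : uniq s -> all (interlaced W a) s ->
  size s <= size (neighbors W a).
Proof.
move=> us /allP as_; apply: uniq_leq_size => // x /as_.
by rewrite mem_neighbors.
Qed.

(** This is how the degree enters: three known neighbors of a letter of degree at most 3 exclude all
    other letters. *)
Lemma neighbors_all W a s x : uniq s -> all (interlaced W a) s ->
  size (neighbors W a) <= size s -> interlaced W a x = (x \in s).
Proof.
move=> us /allP as_ le_s; rewrite -mem_neighbors.
have sub : {subset s <= neighbors W a} by move=> y /as_; rewrite mem_neighbors.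
by have [_ ->] := uniq_min_size us sub le_s.
Qed.

Definition twin_letters W u v :=
  u != v /\ forall x, x != u -> x != v -> interlaced W u x = interlaced W v x.

(** * Factors linked to the rest of the word by a single letter *)

Lemma occ2_split x Q : occ x Q = 2 -> exists A B C, Q = A ++ x :: B ++ x :: C.
Proof.
move=> cQ; have xQ : x \in Q by rewrite mem_occ cQ.
case/splitPr: xQ cQ => p1 p2; rewrite !occE eqxx => cp.
case: (boolP (x \in p1)) => [/splitPr[q1 q2] | xp1].
  by exists q1, q2, p2; rewrite -catA.
have : x \in p2 by move: xp1; rewrite !mem_occ; lia.
by case/splitPr => q1 q2; exists p1, q1, q2.
Qed.

(** Both ends of [x] lie in [Q], and the stretch between them, which decides its interlacements, is
    the same in the two words. *)
Lemma interlaced_factor A Q B w x y :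
  double_occurrence (A ++ Q ++ B) -> double_occurrence (rcons Q w) ->
  x \in Q -> x != w ->
  interlaced (A ++ Q ++ B) x y = interlaced (rcons Q w) x y.
Proof.
move=> dW dQ xQ xw; have := occ_double x dQ.
rewrite mem_rcons inE xQ orbT -cats1 !occE eq_sym (negbTE xw) !addn0 /=.
case/occ2_split=> [A1 [B1 [C1 defQ]]].
move: dW dQ; rewrite defQ -cats1 -!catA /= -!catA catA => dW dQ.
by rewrite !interlaced_between.
Qed.

(** The degree of [h] is only bounded, because closing up a factor can remove neighbors of the
    letter that links it to the rest. *)
Definition pointed_cubic W h :=
  [/\ double_occurrence W,
      forall x, x \in W -> x != h -> size (neighbors W x) = 3 &
      size (neighbors W h) <= 3].

(* The chord of [w] is the only one leaving the factor [Q], and [rcons Q w] closes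
   it up outside. *)
Definition pinched Q w :=
  occ w Q = 1 /\ forall x, x \in Q -> x != w -> occ x Q = 2.

(** Letters of [Q] other than [w] keep all their neighbors; [w] may lose some but gains none. *)
Lemma pointed_cubic_factor A Q B h w : pointed_cubic (A ++ Q ++ B) h ->
  h \notin Q -> pinched Q w -> pointed_cubic (rcons Q w) w.
Proof.
move=> [dW degW _] hQ [w1 Q2].
have wQ : w \in Q by rewrite mem_occ w1.
have inW x : x \in Q -> x \in A ++ Q ++ B.
  by move=> xQ; rewrite !mem_cat xQ orbT.
have neh x : x \in Q -> x != h by apply: contraTneq => ->.
have dQ : double_occurrence (rcons Q w).
  apply/allP => x; rewrite mem_rcons inE -/(occ _ _) -cats1 !occE.
  case: (eqVneq x w) => [-> _ | xw /= xQ]; first by rewrite w1.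
  by rewrite Q2.
split=> // [x | ].
  rewrite mem_rcons inE => /orP[/eqP -> /eqP // | xQ xw].
  rewrite -(degW x) ?inW ?neh //; apply/perm_size/uniq_perm; rewrite ?uniq_neighbors // => y.
  by rewrite !mem_neighbors (interlaced_factor _ dW dQ).
rewrite -(degW w) ?inW ?neh //; apply: leq_size_neighbors (uniq_neighbors _ _) _.
apply/allP => y; rewrite mem_neighbors => wy.
have yw : y != w by case/andP: wy; rewrite eq_sym.
have yQ : y \in Q.
  by have := interlaced_mem wy; rewrite mem_rcons inE (negbTE yw).
by rewrite interlacedC (interlaced_factor _ dW dQ) // interlacedC.
Qed.

Lemma twin_letters_factor A Q B w u v :
  double_occurrence (A ++ Q ++ B) -> double_occurrence (rcons Q w) ->
  u \in Q -> v \in Q -> u != w -> v != w ->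
  twin_letters (rcons Q w) u v -> twin_letters (A ++ Q ++ B) u v.
Proof.
move=> dW dQ uQ vQ uw vw [uv tw]; split=> // x xu xv.
by rewrite !(interlaced_factor _ dW dQ) ?tw.
Qed.

(** * Cutting a smaller instance out of the word around the core *)

Lemma neq_false (x y : nat) : x != y -> ((x == y) = false) * ((y == x) = false).
Proof. by move=> /negbTE xy; rewrite xy eq_sym xy. Qed.

(** The second [q] must fall between the core and the second [t], where it separates [Q1] from [Q2].
    Since [p], [a], [b] exhaust the degree of [t], and [b], [p], [w] that of [q], all other letters
    of [Q1] and [Q2] are confined to one of them. *)
Lemma pinched_factor_of_core L p a s b t q R1 R2 W h :
  W = L ++ [:: p; a; s; b; t; a; q; b; p] ++ R1 ++ t :: R2 ->
  pointed_cubic W h -> last t R2 = h ->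
  exists A Q B w,
    [/\ W = A ++ Q ++ B, h \notin Q, pinched Q w, has (predC1 w) Q &
        (size Q).+1 < size W].
Proof.
move=> defW [dW degW degh] last_h.
have h_end : h \in t :: R2 by rewrite -last_h mem_last.
have inW x : x \in [:: p; a; s; b; t; a; q; b; p] ++ R1 ++ t :: R2 -> x \in W.
  by move=> xR; rewrite defW mem_cat xR orbT.
have degW3 x : x \in W -> size (neighbors W x) <= 3.
  by case: (eqVneq x h) => [-> // | xh /degW->].
(* One linear count for every letter; at [p], [a], [b], [t], [q] it forces these five to be distinct
   and limits where else they occur. *)
have cnt z : 2 * (p == z) + 2 * (a == z) + (s == z) + 2 * (b == z) +
    2 * (t == z) + (q == z) + occ z L + occ z R1 + occ z R2 = 2 * (z \in W).
  by rewrite -(occ_double z dW) defW !occE; clear; lia.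
have betw_t x : interlaced W t x = (t != x) && (occ x ([:: a; q; b; p] ++ R1) == 1).
  rewrite defW (_ : _ ++ _ = (L ++ [:: p; a; s; b]) ++
    t :: ([:: a; q; b; p] ++ R1) ++ t :: R2) in dW *.
    by rewrite interlaced_between.
  by rewrite -!catA.
have cnt5 z : z \in [:: p; a; b; t; q] -> 2 * (p == z) + 2 * (a == z) +
    (s == z) + 2 * (b == z) + 2 * (t == z) + (q == z) + occ z L + occ z R1 +
    occ z R2 = 2.
  by move=> z5; rewrite cnt inW //; move: z5; rewrite !inE; clear; lia.
have [pa pb pt pq pR] : [/\ a != p, b != p, t != p, q != p & occ p R1 = 0].
  by have := cnt5 p (mem_head _ _); clear; move=> *; split; lia.
have [ab at_ aq aR] : [/\ b != a, t != a, q != a & occ a R1 = 0].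
  by have := cnt5 a; rewrite !inE eqxx orbT => /(_ isT); clear; move=> *; split; lia.
have [bt bq bR] : [/\ t != b, q != b & occ b R1 = 0].
  by have := cnt5 b; rewrite !inE eqxx !orbT => /(_ isT); clear; move=> *; split; lia.
have [tq tR] : q != t /\ occ t R1 = 0.
  by have := cnt5 t; rewrite !inE eqxx !orbT => /(_ isT); clear; lia.
have ne := (neq_false pa, neq_false pb, neq_false pt, neq_false pq, neq_false ab,
  neq_false at_, neq_false aq, neq_false bt, neq_false bq, neq_false tq).
(* When [R2] is empty, [t] is [h], so only the bound [degW3] is available for it; this suffices. *)
have Nt x : interlaced W t x = (x \in [:: p; a; b]).
  apply: neighbors_all.
  - by rewrite /= !inE !ne.
  - by rewrite /= !betw_t !occE !ne !eqxx pR aR bR.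
  - by apply: degW3; apply: inW; rewrite !inE eqxx !orbT.
(* [q] has an end between the two [t] without being a neighbor of [t], so its other end is there
   too. *)
have qR1 : q \in R1.
  have := betw_t q; rewrite Nt !occE !inE !ne eqxx mem_occ /=.
  by case: (occ q R1).
case/splitPr: qR1 => Q1 Q2 in defW inW cnt cnt5 pR aR bR tR betw_t *.
rewrite !occE in pR aR bR tR.
have [pQ aQ bQ tQ] : [/\ occ p Q1 = 0, occ a Q1 = 0, occ b Q1 = 0 & occ t Q1 = 0].
  by split; [move: pR | move: aR | move: bR | move: tR]; clear; lia.
have {}cnt5 : 2 + (s == q) + occ q L + occ q Q1 + occ q Q2 + occ q R2 = 2.
  have := cnt5 q; rewrite !occE !inE eqxx !orbT !ne => /(_ isT).
  by clear; lia.
have qW : q \in W by apply: inW; rewrite !inE eqxx !orbT.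
have qh : q != h.
  apply: contraTneq h_end => <-; rewrite mem_occ !occE.
  by move: cnt5 tq; clear; lia.
have betw_q x : interlaced W q x = (q != x) && (occ x ([:: b; p] ++ Q1) == 1).
  rewrite defW (_ : _ ++ _ = (L ++ [:: p; a; s; b; t; a]) ++
    q :: ([:: b; p] ++ Q1) ++ q :: (Q2 ++ t :: R2)) in dW *.
    by rewrite interlaced_between.
  by rewrite -?catA /= -?catA.
(* [q] differs from [h], so it has a third neighbor besides [b] and [p]. *)
have [w qw w_bp] : exists2 w, w \in neighbors W q & w \notin [:: b; p].
  apply/allPn/negP => /allP sub.
  by have := uniq_leq_size (uniq_neighbors W q) sub; rewrite degW.
rewrite mem_neighbors betw_q !occE in qw.
rewrite !inE negb_or in w_bp; case/andP: w_bp qw => wb wp.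
rewrite !(eq_sym _ w) (negbTE wb) (negbTE wp) !add0n => /andP[wq /eqP w1].
have Nq x : interlaced W q x = (x \in [:: b; p; w]).
  apply: neighbors_all; last by rewrite degW.
  - by rewrite /= !inE !ne !(neq_false wb) !(neq_false wp).
  - rewrite /= !betw_q !occE w1 pQ bQ !ne !(neq_false wb) !(neq_false wp).
    by rewrite !eqxx !(neq_false wq).
have notin_Q1 z : occ z Q1 = 0 -> w != z.
  by move=> z0; apply/eqP => wz; rewrite wz z0 in w1.
have wa := notin_Q1 a aQ; have wt := notin_Q1 t tQ.
have occ_le z : occ z L + occ z Q1 + occ z Q2 + occ z R2 <= 2.
  by have := occ_double_leq z dW; rewrite defW !occE; clear; lia.
(* Since [w] does not cross [t], its end in [Q1] is not the only one between the two [t]. *)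
have w2 : occ w Q2 = 1.
  have := betw_t w; rewrite Nt !inE !occE (negbTE wp) (negbTE wa) (negbTE wb) /=.
  rewrite !(neq_false wa) !(neq_false wb) !(neq_false wp) !(neq_false wt).
  by rewrite !(neq_false wq) w1 /=; move: (occ_le w); rewrite w1; clear; lia.
(* A letter other than [w] with a single end in [Q1] would be a fourth neighbor of [q]. *)
have cQ1 : pinched Q1 w.
  split=> // x; rewrite mem_occ => xQ1 xw.
  have := betw_q x; rewrite Nq !inE (negbTE xw) !occE.
  have xp : x != p by apply: contraTneq xQ1 => ->; rewrite pQ.
  have xb : x != b by apply: contraTneq xQ1 => ->; rewrite bQ.
  have xq : x != q by apply: contraTneq xQ1 => ->; move: cnt5; clear; lia.
  rewrite !(neq_false xp) !(neq_false xb) !(neq_false xq) /=.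
  by move: (occ_le x) xQ1; clear; lia.
(* Such an [x] crosses neither [q] nor [t], so it has a single end neither in [Q1] nor in [Q1] and
   [Q2] together; both its ends are in [Q2]. *)
have cQ2 : pinched Q2 w.
  split=> // x; rewrite mem_occ => xQ2 xw.
  have xp : x != p by apply: contraTneq xQ2 => ->; move: pR; clear; lia.
  have xa : x != a by apply: contraTneq xQ2 => ->; move: aR; clear; lia.
  have xb : x != b by apply: contraTneq xQ2 => ->; move: bR; clear; lia.
  have xt : x != t by apply: contraTneq xQ2 => ->; move: tR; clear; lia.
  have xq : x != q by apply: contraTneq xQ2 => ->; move: cnt5; clear; lia.
  have := betw_t x; have := betw_q x; rewrite Nt Nq !inE (negbTE xw) !occE.
  rewrite !(neq_false xp) !(neq_false xa) !(neq_false xb) !(neq_false xq).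
  by rewrite !(neq_false xt) /=; move: (occ_le x) xQ2; clear; lia.
have occ_h : 0 < (t == h) + occ h R2.
  by move: h_end; rewrite mem_occ occ_cons.
have hQ1 : h \notin Q1.
  apply/negP => hQ1; case: (eqVneq h w) => [hw | /(proj2 cQ1 h hQ1) h2].
    by have := occ_le w; move: occ_h; rewrite w1 w2 hw (neq_false wt); clear; lia.
  have := occ_le h; rewrite h2; move: occ_h; case: eqP h2 => [<-|_]; last by clear; lia.
  by rewrite tQ.
have hQ2 : h \notin Q2.
  apply/negP => hQ2; case: (eqVneq h w) => [hw | /(proj2 cQ2 h hQ2) h2].
    by move/negP: hQ1; rewrite mem_occ hw w1.
  have := occ_le h; rewrite h2; move: occ_h; case: eqP h2 => [<-|_]; last by clear; lia.
  by move: tR; clear; lia.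
(* The induction needs a factor with some letter besides [w]. A neighbor of [w] other than [q] has
   an end between the two [w], hence in [Q1] or [Q2]. *)
suff [fQ | fQ] : has (predC1 w) Q1 \/ has (predC1 w) Q2.
- exists (L ++ [:: p; a; s; b; t; a; q; b; p]), Q1, (q :: Q2 ++ t :: R2), w.
  split; rewrite // defW ?size_cat /= -?catA //= ?size_cat /=; by clear; lia.
- exists (L ++ [:: p; a; s; b; t; a; q; b; p] ++ Q1 ++ [:: q]), Q2, (t :: R2), w.
  split; rewrite // defW ?size_cat /= -?catA //= ?size_cat /= -?catA //; by clear; lia.
have [wQ1 wQ2] : w \in Q1 /\ w \in Q2 by rewrite !mem_occ w1 w2.
have wh : w != h by apply: contraNneq hQ1 => <-.
have wW : w \in W by rewrite mem_occ defW !occE w1; clear; lia.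
have [x wx xq] : exists2 x, x \in neighbors W w & x \notin [:: q].
  apply/allPn/negP => /allP sub.
  by have := uniq_leq_size (uniq_neighbors W w) sub; rewrite degW.
rewrite mem_neighbors in wx.
clear -defW dW wx xq wQ1 wQ2.
case/splitPr: wQ1 => D E in defW *; case/splitPr: wQ2 => F G in defW *.
rewrite defW (_ : _ ++ _ = (L ++ [:: p; a; s; b; t; a; q; b; p] ++ D) ++
    w :: (E ++ q :: F) ++ w :: (G ++ t :: R2)) in dW wx.
  rewrite (interlaced_between _ dW) in wx.
  case/andP: wx => xw /eqP cx.
  have : x \in E ++ q :: F by rewrite mem_occ cx.
  rewrite mem_cat inE -(mem_seq1 x q) (negbTE xq) /= => /orP[] xEF.
    by left; apply/hasP; exists x; rewrite /= 1?eq_sym // mem_cat inE xEF !orbT.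
  by right; apply/hasP; exists x; rewrite /= 1?eq_sym // mem_cat xEF.
by rewrite -?catA /= -?catA /= -?catA.
Qed.

(** * Patterns of chords of length 4 *)

Definition unpaired N (st : pred nat) i :=
  [&& i < N, ~~ st i & (4 <= i) ==> ~~ st (i - 4)].

(* The predicate [st] marks the first position of each pair [{i, i + 4}] of
   equal letters in a word of length [N]. *)
Lemma start_pattern N (st : pred nat) (half := unpaired N st) :
  (forall i, st i -> i + 4 < N) -> (forall i, st i -> ~~ st (i + 4)) ->
  (forall i, st i -> ~~ st i.+1) ->
  (forall l, uniq l -> all half l -> size l <= 3) -> (exists i, st i) ->
  (exists i, [/\ st i, half (i + 1), half (i + 2) & half (i + 3)]) \/
  [/\ N = 7, st 0 & st 2].
Proof.
move=> ltN st4 st1 h3 ex_st.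
have [i0 s0 min_i0] := ex_minnP ex_st.
have nmin k : k < i0 -> st k = false.
  by move=> lt_k; apply/negP => /min_i0; rewrite leqNgt lt_k.
have n4 k : st (i0 + k) -> st (i0 + (k + 4)) = false.
  by move=> /st4; rewrite -addnA => /negbTE.
have n1 k : st (i0 + k) -> st (i0 + k.+1) = false.
  by move=> /st1; rewrite addnS => /negbTE.
have lt k : st (i0 + k) -> i0 + k + 4 < N by apply: ltN.
have h0 k : 0 < k < 4 -> st (i0 + k) = false -> half (i0 + k).
  move=> /andP[k0 k4] sk; apply/and3P; split; rewrite ?sk //.
    by rewrite (leq_trans _ (ltN _ s0)) // ltnS leq_add2l ltnW.
  by apply/implyP => ge4; rewrite nmin // ltn_subLR // addnC ltn_add2r.
(* The index [j] serves only to show that the position [i0 + (k + 4)] is inside the word. *)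
have hk k j : k <= j -> i0 + j + 4 < N -> st (i0 + k) = false ->
    st (i0 + (k + 4)) = false -> half (i0 + (k + 4)).
  move=> kj jN sk sk4; apply/and3P; split; rewrite ?sk4 //.
    by rewrite (leq_trans _ jN) // ltnS addnA leq_add2r leq_add2l.
  by apply/implyP => _; rewrite addnA addnK sk.
(* Every impossible branch below yields four distinct unpaired offsets from the least start [i0]: a
   branch that survives by one more start leaves a later offset unpaired. *)
have no4 k1 k2 k3 k4 : half (i0 + k1) -> half (i0 + k2) -> half (i0 + k3) ->
    half (i0 + k4) -> uniq [:: k1; k2; k3; k4] -> False.
  move=> a1 a2 a3 a4 u.
  have := h3 (map (addn i0) [:: k1; k2; k3; k4]).
  rewrite map_inj_uniq; last by move=> x y /addnI.
  by rewrite u /= a1 a2 a3 a4 /= => /(_ isT isT).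
have {}s0 : st (i0 + 0) by rewrite addn0.
have l0 := lt _ s0.
have s1 := n1 _ s0; have h1 := h0 1 isT s1; have s4 := n4 _ s0.
case s2: (st (i0 + 2)); last first.
  have h2 := h0 2 isT s2.
  case s3: (st (i0 + 3)); last first.
    by left; exists i0; split=> //; [rewrite -(addn0 i0) | apply: h0].
  have l3 := lt _ s3; have s7 := n4 _ s3.
  have noh := no4 1 2 _ _ h1 h2; case s5: (st (i0 + 5)).
    have l5 := lt _ s5; have s6 := n1 _ s5.
    have {}noh := noh 6 _ (hk 2 5 isT l5 s2 s6).
    case s8: (st (i0 + 8)); last by case: (noh 8 (hk 4 5 isT l5 s4 s8)).
    have l8 := lt _ s8.
    case s10: (st (i0 + 10)); last by case: (noh 10 (hk 6 8 isT l8 s6 s10)).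
    have l10 := lt _ s10; have s11 := n1 _ s10.
    by case: (noh 11 (hk 7 10 isT l10 s7 s11)).
  have {}noh := noh 5 _ (hk 1 3 isT l3 s1 s5).
  case s6: (st (i0 + 6)); last by case: (noh 6 (hk 2 3 isT l3 s2 s6)).
  have l6 := lt _ s6.
  case s8: (st (i0 + 8)); last by case: (noh 8 (hk 4 6 isT l6 s4 s8)).
  have l8 := lt _ s8; have s9 := n1 _ s8.
  by case: (noh 9 (hk 5 8 isT l8 s5 s9)).
have s3 := n1 _ s2; have h33 := h0 3 isT s3; have l2 := lt _ s2.
have s6 := n4 _ s2; have noh := no4 1 3 _ _ h1 h33.
case s5: (st (i0 + 5)).
  have l5 := lt _ s5; have s9 := n4 _ s5.
  case s7: (st (i0 + 7)).
    have l7 := lt _ s7; have s8 := n1 _ s7; have s11 := n4 _ s7.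
    have {}noh := noh 8 _ (hk 4 7 isT l7 s4 s8).
    case s10: (st (i0 + 10)); last by case: (noh 10 (hk 6 7 isT l7 s6 s10)).
    have l10 := lt _ s10.
    case s12: (st (i0 + 12)); last by case: (noh 12 (hk 8 10 isT l10 s8 s12)).
    have l12 := lt _ s12; have s13 := n1 _ s12.
    by case: (noh 13 (hk 9 12 isT l12 s9 s13)).
  have {}noh := noh 7 _ (hk 3 5 isT l5 s3 s7).
  case s8: (st (i0 + 8)); last by case: (noh 8 (hk 4 5 isT l5 s4 s8)).
  have l8 := lt _ s8.
  case s10: (st (i0 + 10)); last by case: (noh 10 (hk 6 8 isT l8 s6 s10)).
  have l10 := lt _ s10; have s11 := n1 _ s10.
  by case: (noh 11 (hk 7 10 isT l10 s7 s11)).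
have h5 := hk 1 2 isT l2 s1 s5; have {}noh := noh 5 _ h5.
have [N7 | N7] := ltnP (i0 + 7) N.
  case s7: (st (i0 + 7)).
    have l7 := lt _ s7; have s8 := n1 _ s7.
    by case: (noh 8 (hk 4 7 isT l7 s4 s8)).
  case: (noh 7) => //; apply/and3P; split; rewrite ?s7 //.
  by rewrite (_ : 7 = 3 + 4) // addnA addnK s3 implybT.
(* If [i0] were positive, position 0 would be unpaired, a fourth one besides the offsets 1, 3 and
   5. *)
right; have i00 : i0 = 0.
  case: (posnP i0) => // i0_gt0.
  have half0 : half 0 by rewrite /half /unpaired nmin // (leq_trans _ l0) ?addnS.
  have u : uniq [:: 0; i0 + 1; i0 + 3; i0 + 5].
    by rewrite /= !inE !eqn_add2l !addnS.
  have h5' : half (i0 + 5) by [].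
  by have := h3 _ u; rewrite /= half0 h1 h33 h5' => /(_ isT).
move: s0 s2 l2 N7; rewrite i00 !add0n => s0 s2 l2 N7; split=> //.
by apply/eqP; rewrite eqn_leq N7 l2.
Qed.

(** * Minimal factors between equal letters *)

Lemma nth2_split (U : seq nat) i j : i < j < size U ->
  exists A B C, [/\ U = A ++ nth 0 U i :: B ++ nth 0 U j :: C,
                    size A = i & size B = j - i.+1].
Proof.
case/andP=> ij jU.
exists (take i U), (take (j - i.+1) (drop i.+1 U)), (drop j.+1 U); split.
- rewrite -(drop_nth 0 jU) -[in drop j U](subnK ij) -drop_drop.
  by rewrite cat_take_drop -drop_nth ?cat_take_drop // (ltn_trans ij).
- by rewrite size_takel // ltnW // (ltn_trans ij).
- by rewrite size_takel // size_drop leq_sub2r // ltnW.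
Qed.

Lemma occ_nth1 (U : seq nat) i : i < size U ->
  (forall j, j < size U -> nth 0 U j = nth 0 U i -> j = i) -> occ (nth 0 U i) U = 1.
Proof.
move=> iU inj; apply/eqP.
have : nth 0 U i \in U by apply: mem_nth.
rewrite mem_occ eqn_leq => ->; rewrite andbT leqNgt; apply/negP => occ2.
have : nth 0 U i \in drop i.+1 U ++ take i U.
  rewrite mem_occ occE; move: occ2.
  rewrite -{2}(cat_take_drop i U) (drop_nth 0 iU) !occE eqxx; clear; lia.
rewrite mem_cat => /orP[] /(nthP 0)[k].
  rewrite size_drop nth_drop ltn_subRL => kU /inj E; have := E kU; clear; lia.
rewrite size_takel ?(ltnW iU) // => ki; rewrite nth_take // => /inj E.
have := E (ltn_trans ki iU); move: ki; clear; lia.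
Qed.

(** The two cases are the word without its final [h] and the stretch between two equal letters [p].
    Asking for [h] in [R] ensures that no letter with both ends in [U] is [h]. *)
Definition side (W : seq nat) (h : nat) (U : seq nat) :=
  exists L R, [/\ W = L ++ U ++ R, h \in R &
  (L = [::] /\ R = [:: h]) \/
  exists p L' R', [/\ L = rcons L' p, R = p :: R' & p != h]].

Definition short_chords (U : seq nat) := forall i j,
  i < j < size U -> nth 0 U i = nth 0 U j -> j = i + 4.

Lemma side_neq W h U x : double_occurrence W -> side W h U -> 1 < occ x U -> x != h.
Proof.
move=> dW [L [R [defW hR _]]] x2; apply/eqP => xh.
have := occ_double_leq x dW; rewrite mem_occ -xh in hR.
by rewrite defW !occE; move: hR x2; clear; lia.
Qed.

Lemma side_inner W h U x A B C : double_occurrence W -> side W h U ->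
  U = A ++ x :: B ++ x :: C -> side W h B.
Proof.
move=> dW sU defU; have xh : x != h.
  by apply: (side_neq dW sU); rewrite defU !occE eqxx; clear; lia.
have [L [R [defW hR _]]] := sU.
exists (rcons (L ++ A) x), (x :: C ++ R); split.
- by rewrite defW defU -cats1 -!catA /= -?catA.
- by rewrite inE mem_cat hR !orbT.
- by right; exists x, (L ++ A), (C ++ R).
Qed.

(** Descent on the length of the factor: if the ends of [x] are not 4 apart, pass to the stretch [B]
    between them. Were no letter to occur twice in [B], then [B] would list the three neighbors of
    [x] once each, and the distance would be 4. *)
Lemma exists_short_side W h Q : W = rcons Q h -> pointed_cubic W h ->
  has (predC1 h) Q ->
  exists U, [/\ side W h U, exists x, occ x U = 2 & short_chords U].
Proof.
move=> defW [dW degW _] /hasP[x0 x0Q /= x0h].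
have sQ : side W h Q.
  exists [::], [:: h]; split; [by rewrite cats1 | exact: mem_head | by left].
have {x0 x0Q x0h} : exists x, occ x Q = 2.
  exists x0; have := occ_double x0 dW; rewrite defW mem_rcons inE x0Q orbT.
  by rewrite -cats1 !occE (neq_false x0h); clear; lia.
have [n] := ubnP (size Q); elim: n Q sQ {defW} => // n IHn U sU ltU fullU.
have [/forallP short | ] := boolP [forall i : 'I_(size U), forall j : 'I_(size U),
   (i < j) ==> (nth 0 U i == nth 0 U j) ==> (j == i + 4 :> nat)].
  exists U; split=> // i j /andP[ij jU] eij.
  have /forallP/(_ (Ordinal jU)) := short (Ordinal (ltn_trans ij jU)).
  by rewrite /= ij eij eqxx => /eqP.
case/forallPn=> i /forallPn[j]; rewrite !negb_imply => /and3P[ij /eqP eij nij].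
have [|A [B [C [defU sA sB]]]] := @nth2_split U i j; first by rewrite ij /=.
rewrite -eij in defU; set x := nth 0 U i in defU.
have sideB := side_inner dW sU defU.
have xh : x != h.
  by apply: (side_neq dW sU); rewrite [X in occ x X]defU !occE eqxx; clear; lia.
have [L [R [defW _ _]]] := sU.
have defW' : W = (L ++ A) ++ x :: B ++ x :: (C ++ R).
  by rewrite defW defU -!catA /= -?catA.
have betw y : interlaced W x y = (x != y) && (occ y B == 1).
  by rewrite defW' interlaced_between // -defW'.
have degx : size (neighbors W x) = 3.
  by apply: degW => //; rewrite defW' mem_cat inE eqxx orbT.
have xB : occ x B = 0.
  by have := occ_double_leq x dW; rewrite defW' !occE eqxx; clear; lia.
apply: IHn sideB _ _.
  rewrite -ltnS; apply: leq_trans ltU; rewrite ltnS defU !size_cat /= size_cat /=; clear; lia.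
have occB y : y \in B -> occ y B != 2 -> occ y B = 1.
  by rewrite mem_occ; have := occ_double_leq y dW; rewrite defW' !occE; clear; lia.
have [/hasP[y _ /eqP y2] | /hasPn noB] := boolP (has (fun y => occ y B == 2) B).
  by exists y.
have {}occB y : y \in B -> occ y B = 1 by move=> yB; apply: occB (noB _ yB).
have uB : uniq B.
  by apply: count_mem_uniq => y; case: (boolP (y \in B)) => [/occB // | /count_memPn].
suff sizeB : size B = 3.
  by case/eqP: nij; rewrite sB in sizeB; move: ij sizeB; clear; lia.
rewrite -degx; apply/perm_size/uniq_perm; rewrite ?uniq_neighbors // => y.
rewrite mem_neighbors betw mem_occ; case: (eqVneq x y) => [<- | xy]; first by rewrite xB.
by move: (occB y); rewrite mem_occ; case: (occ y B) => // m -> .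
Qed.

(** A letter with one end in [U] crosses [p]; when [U] is the whole word before [h], only [h] has an
    end outside. *)
Lemma side_singles W h U : pointed_cubic W h -> side W h U ->
  (forall x, occ x U = 1 -> x = h) \/
  exists p L R, [/\ W = L ++ p :: U ++ p :: R, p != h, h \in R &
                    forall x, occ x U = 1 -> interlaced W p x].
Proof.
move=> [dW _ _] [L [R [defW hR []]]] [].
  move=> L0 R0; left=> x x1; apply/eqP/idPn => /neq_false xh.
  have := occ_double x dW; rewrite defW L0 R0 !occE x1 !xh; clear; lia.
move=> p [L' [R' [defL defR ph]]]; right.
have {}defW : W = L' ++ p :: U ++ p :: R' by rewrite defW defL defR cat_rcons.
have hR' : h \in R' by move: hR; rewrite defR inE eq_sym (negbTE ph).
exists p, L', R'; split=> // x x1; rewrite defW interlaced_between -?defW // x1 andbT.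
apply/eqP => px; have := occ_double_leq p dW; rewrite -px in x1.
by rewrite defW !occE x1 eqxx; clear; lia.
Qed.

(** * Twins inside a minimal factor, or the core *)

Definition twins_avoiding W h := exists u v,
  [/\ u \in W, v \in W, u != h, v != h & twin_letters W u v].

(** Between the ends of [a] lie [b], [s], [t], and between those of [b] lie [s], [t], [a]; outside
    [a] and [b] these give the same neighbors. *)
Lemma adjacent_starts W h U i : double_occurrence W -> side W h U ->
  short_chords U -> i + 5 < size U ->
  nth 0 U i = nth 0 U (i + 4) -> nth 0 U i.+1 = nth 0 U (i + 5) ->
  twins_avoiding W h.
Proof.
move=> dW sU short iU; have [L [R [defW _ _]]] := sU.
rewrite -[i in nth _ _ i]addn0 -[i.+1]addn1 -!nth_drop.
have : 5 < size (drop i U) by rewrite size_drop ltn_subRL.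
have := cat_take_drop i U; case: (drop i U) => [|a [|b [|s [|t [|a' [|b' C]]]]]] //=.
set A := take i U => defU _ aa' bb'; subst a' b'.
have ab : a != b.
  apply/eqP => ab.
  have sA : size A = i by rewrite size_takel // (leq_trans _ iU) // -addnS leq_addr.
  have := short i i.+1; rewrite -{2 3}defU !nth_cat sA ltnn subnn.
  rewrite [i.+1 < i]ltnNge leqnSn subSnn /= => /(_ _ ab) short1.
  by move: iU short1; clear => iU H; have := H ltac:(lia); lia.
have neh x : 1 < occ x U -> x != h by apply: (side_neq dW sU).
have inW x : x \in U -> x \in W by move=> xU; rewrite defW !mem_cat xU orbT.
have [ah bh] : a != h /\ b != h.
  by split; apply: neh; rewrite -defU !occE eqxx; clear; lia.
have [aW bW] : a \in W /\ b \in W.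
  by split; apply: inW; rewrite -defU mem_cat !inE eqxx !orbT.
exists a, b; split=> //; split=> // x xa xb.
have defW1 : W = (L ++ A) ++ a :: [:: b; s; t] ++ a :: (b :: C ++ R).
  by rewrite defW -defU -!catA.
have defW2 : W = (L ++ A ++ [:: a]) ++ b :: [:: s; t; a] ++ b :: (C ++ R).
  by rewrite defW -defU -!catA.
have -> : interlaced W a x = (a != x) && (occ x [:: b; s; t] == 1).
  by rewrite defW1 interlaced_between // -defW1.
have -> : interlaced W b x = (b != x) && (occ x [:: s; t; a] == 1).
  by rewrite defW2 interlaced_between // -defW2.
by rewrite !occE !(neq_false xa) !(neq_false xb); congr (_ == _); clear; lia.
Qed.

(** The three letters of [B] exhaust the degree of [p], and they are exactly what lies between the
    ends of [a]. *)
Lemma chord_with_single_inside W h L p U R A a B C :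
  pointed_cubic W h -> W = L ++ p :: U ++ p :: R -> p != h -> h \in R ->
  U = A ++ a :: B ++ a :: C -> uniq B -> size B = 3 ->
  (forall x, x \in B -> interlaced W p x) -> twins_avoiding W h.
Proof.
move=> [dW degW _] defW ph hR defU uB sB pB.
have [pW aW] : p \in W /\ a \in W.
  by rewrite defW defU !(mem_cat, inE) !eqxx !orbT.
have pa : p != a.
  apply/eqP=> pa; have := occ_double_leq a dW.
  by rewrite defW defU pa !occE eqxx; clear; lia.
have ah : a != h.
  apply: contraTneq hR => <-; rewrite mem_occ; have := occ_double_leq a dW.
  by rewrite defW defU !occE eqxx; clear; lia.
exists p, a; split=> //; split=> // x xp xa.
have -> : interlaced W p x = (x \in B).
  by apply: neighbors_all; rewrite ?degW ?sB //; apply/allP.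
have defW1 : W = (L ++ p :: A) ++ a :: B ++ a :: (C ++ p :: R).
  by rewrite defW defU -!catA /= -?catA /= -?catA.
have -> : interlaced W a x = (a != x) && (occ x B == 1).
  by rewrite defW1 interlaced_between // -defW1.
by rewrite eq_sym xa /= /occ count_uniq_mem //; case: (x \in B).
Qed.

(** If no two consecutive positions are starts, [start_pattern] applies: its first outcome gives
    twins [p] and [a], its second is the core. *)
Lemma twins_or_core W h U : pointed_cubic W h -> side W h U ->
  (exists x, occ x U = 2) -> short_chords U ->
  twins_avoiding W h \/
  exists L p a s b t q R, [/\ W = L ++ [:: p; a; s; b; t; a; q; b; p] ++ R,
    p != h, h \in R & occ t [:: a; s; b; t; a; q; b] = 1].
Proof.
move=> pcW sU [x x2] short; have [dW degW _] := pcW.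
pose st i := (i + 4 < size U) && (nth 0 U i == nth 0 U (i + 4)).
have [/hasP[i _ /andP[/andP[_ /eqP si] /andP[iU /eqP si1]]] | /hasPn no2] :=
    boolP (has (fun i => st i && st i.+1) (iota 0 (size U))).
  by rewrite addSnnS in iU si1; left; apply: (adjacent_starts dW sU short iU si si1).
pose half := unpaired (size U) st.
have half_inj i j : half i -> j < size U -> nth 0 U j = nth 0 U i -> j = i.
  case/and3P=> iU nsi nsi4 jU eij; case: (ltngtP j i) => // ij.
    have i4 := short j i; rewrite ij iU in i4; have {}i4 := i4 isT eij.
    by move: nsi4; rewrite i4 leq_addl addnK /st -i4 iU eij eqxx.
  have j4 := short i j; rewrite ij jU in j4; have {}j4 := j4 isT (esym eij).
  by move: nsi; rewrite /st -j4 jU eij eqxx.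
have half1 i : half i -> occ (nth 0 U i) U = 1.
  move=> hi; apply: occ_nth1 => [|j]; [by case/and3P: hi | exact: half_inj].
have half_lt i : half i -> i < size U by case/and3P.
have sing := side_singles pcW sU.
(* Two unpaired positions carry different letters, so they cannot both carry [h]; this excludes the
   case where [U] is the whole word before [h]. *)
have half_p i j : half i -> half j -> i != j ->
    exists p L R, [/\ W = L ++ p :: U ++ p :: R, p != h, h \in R &
                    forall x, occ x U = 1 -> interlaced W p x].
  case: sing => [eq_h hi hj /eqP[] | //]; apply: (half_inj _ _ hj (half_lt _ hi)).
  by rewrite (eq_h _ (half1 _ hi)) (eq_h _ (half1 _ hj)).
have [||||||] := @start_pattern (size U) st.
- by move=> i /andP[].
- move=> i /andP[iU /eqP si]; apply/negP => /andP[iU4 /eqP si4].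
  have := short i (i + 4 + 4); rewrite iU4 -si4 si; clear => H.
  by have := H ltac:(lia) erefl; lia.
- move=> i si; apply/negP => si1; have /andP[iU _] := si.
  have := no2 i; rewrite mem_iota si si1 /=.
  by rewrite (leq_ltn_trans (leq_addr 4 i) iU) => /(_ isT).
(* Letters at unpaired positions are all equal to [h], or all neighbors of [p], which has degree
   3. *)
- move=> l ul hl; have ul' : uniq [seq nth 0 U i | i <- l].
    rewrite map_inj_in_uniq // => i j il jl eij.
    by apply: (half_inj _ _ (allP hl _ jl) (half_lt _ (allP hl _ il)) eij).
  rewrite -(size_map (nth 0 U)); case: sing => [eq_h | [p [L [R [defW ph _ pU]]]]].
    have : all (pred1 h) [seq nth 0 U i | i <- l].
      by apply/allP => _ /mapP[i il ->]; apply/eqP/eq_h/half1/(allP hl).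
    case: [seq nth 0 U i | i <- l] ul' => [|y [|z s]] //= us /and3P[/eqP yh /eqP zh _].
    by rewrite yh zh inE eqxx in us.
  have pl : all (interlaced W p) [seq nth 0 U i | i <- l].
    by apply/allP => _ /mapP[i il ->]; apply/pU/half1/(allP hl).
  have pW : p \in W by rewrite defW mem_cat mem_head orbT.
  by rewrite -(degW p pW ph); apply: leq_size_neighbors.
- have [A [B [C defU]]] := occ2_split x2.
  have n_i : nth 0 U (size A) = x by rewrite defU nth_cat ltnn subnn.
  have n_j : nth 0 U (size (A ++ x :: B)) = x.
    by rewrite defU -cat_cons catA nth_cat ltnn subnn.
  have lt_jU : size (A ++ x :: B) < size U.
    by rewrite defU !size_cat /= size_cat /=; clear; lia.
  have lt_ij : size A < size (A ++ x :: B) by rewrite size_cat /=; clear; lia.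
  have := short _ _ _ (etrans n_i (esym n_j)); rewrite lt_ij lt_jU => /(_ isT) j4.
  by exists (size A); rewrite /st -j4 lt_jU n_i n_j eqxx.
- case=> i [si h1 h2 h3]; left; have /andP[iU /eqP si4] := si.
  have [|p [L [R [defW ph hR pU]]]] := half_p _ _ h1 h2; first by rewrite eqn_add2l.
  have [|A [B [C [defU sA sB]]]] := @nth2_split U i (i + 4).
    by rewrite iU -addn1 leq_add2l.
  have {}sB : size B = 3 by rewrite sB; clear; lia.
  have hk k : k < 3 -> half (i + k.+1) by case: k => [|[|[|]]].
  have nB k : k < 3 -> nth 0 B k = nth 0 U (i + k.+1).
    move=> k3; rewrite defU nth_cat sA ltnNge leq_addr addKn /= nth_cat sB.
    by rewrite k3.
  rewrite -si4 in defU.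
  apply: (chord_with_single_inside pcW defW ph hR defU _ sB).
    apply/(uniqP 0) => k l; rewrite !inE sB => k3 l3; rewrite !nB // => e.
    by have /addnI[] := half_inj _ _ (hk _ l3) (half_lt _ (hk _ k3)) e.
  move=> z /(nthP 0)[k]; rewrite sB => k3 <-; rewrite nB //.
  exact/pU/half1/hk.
(* Seven letters with starts 0 and 2 read [a s b t a q b]. *)
- case=> N7 s0 s2; right.
  have ns1 : ~~ st 1 by have := no2 0; rewrite mem_iota N7 s0 => /(_ isT).
  have h1 : half 1 by rewrite /half /unpaired N7 ns1.
  have h3 : half 3 by rewrite /half /unpaired /st N7.
  have [//|p [L [R [defW ph hR _]]]] := half_p _ _ h1 h3.
  move: N7 s0 s2 defW (half1 _ h3); rewrite /st; clear -ph hR.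
  case: U => [|a [|s [|b [|t [|a' [|q [|b' [|? ?]]]]]]]] //= _ /eqP<- /eqP<- defW t1.
  by exists L, p, a, s, b, t, q, R.
Qed.

(** * Invariance under equal interlacement, and the induction *)

Lemma twin_letters_eq W W' u v : (forall x y, interlaced W x y = interlaced W' x y) ->
  twin_letters W u v -> twin_letters W' u v.
Proof. by move=> eqW [uv tw]; split=> // x xu xv; rewrite -!eqW tw. Qed.

Lemma pointed_cubic_eq W W' h : (forall x y, interlaced W x y = interlaced W' x y) ->
  perm_eq W W' -> pointed_cubic W h -> pointed_cubic W' h.
Proof.
move=> eqW pW [dW degW degh].
have size_nb x : size (neighbors W' x) = size (neighbors W x).
  apply/perm_size/uniq_perm; rewrite ?uniq_neighbors // => y.
  by rewrite !mem_neighbors eqW.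
split=> [|x|]; rewrite ?size_nb // -?(perm_mem pW); last exact: degW.
by rewrite /double_occurrence -(perm_all _ pW); apply: sub_all dW => x; rewrite (permP pW).
Qed.

Lemma twins_avoiding_eq W W' h : (forall x y, interlaced W x y = interlaced W' x y) ->
  perm_eq W W' -> twins_avoiding W h -> twins_avoiding W' h.
Proof.
move=> eqW pW [u [v [uW vW uh vh tw]]]; exists u, v.
by split; rewrite -?(perm_mem pW) //; apply: twin_letters_eq tw.
Qed.

Lemma twins_avoiding_point Q h : pointed_cubic (rcons Q h) h ->
  has (predC1 h) Q -> twins_avoiding (rcons Q h) h.
Proof.
have [n] := ubnP (size Q); elim: n Q h => // n IHn Q h ltQ pcW fullQ.
(* The case where the second [t] is to the right of the core. Twins of the smaller word differ from
   [h] because [h] is not in the factor [Q']. *)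
have via_core W L p a s b t q R1 R2 : pointed_cubic W h -> size W = (size Q).+1 ->
    W = L ++ [:: p; a; s; b; t; a; q; b; p] ++ R1 ++ t :: R2 -> last t R2 = h ->
    twins_avoiding W h.
  move=> pcW' sW defW last_h.
  have [A [Q' [B [w [defW' hQ' pinQ' fullQ' ltQ']]]]] :=
    pinched_factor_of_core defW pcW' last_h.
  rewrite defW' in pcW' *; have pcQ' := pointed_cubic_factor pcW' hQ' pinQ'.
  have [||u [v [uQ vQ uw vw tw]]] := IHn Q' w _ pcQ' => //.
    by rewrite -ltnS; apply: leq_trans ltQ; rewrite ltnS -ltnS -sW.
  rewrite mem_rcons inE (negbTE uw) /= in uQ.
  rewrite mem_rcons inE (negbTE vw) /= in vQ.
  exists u, v; split; rewrite ?mem_cat ?uQ ?vQ ?orbT //.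
  - by apply: contraTneq uQ => ->.
  - by apply: contraTneq vQ => ->.
  - by case: pcW' pcQ' => [dW _ _] [dQ' _ _]; apply: twin_letters_factor tw.
have [U [sU fullU short]] := exists_short_side (erefl _) pcW fullQ.
have [// | [L [p [a [s [b [t [q [R [defW ph hR t1]]]]]]]]]] :=
  twins_or_core pcW sU fullU short.
have [R' defR] : exists R', R = rcons R' h.
  case/lastP: R hR defW {t1} => // R' z _; rewrite -!rcons_cat => /rcons_inj[_ <-].
  by exists R'.
have : (t \in R) || (t \in L).
  have tW : t \in rcons Q h by rewrite defW !(mem_cat, inE) eqxx !orbT.
  have [dW _ _] := pcW; have := occ_double t dW; rewrite tW defW !mem_occ.
  by move: t1; rewrite !occE; clear; lia.
case/orP=> [tR | tL].
  case/splitPr: tR defW defR => R1 R2 defW defR.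
  apply: (via_core _ _ _ _ _ _ _ _ _ _ pcW _ defW); first by rewrite size_rcons.
  by have := congr1 (last h) defR; rewrite last_cat last_rcons.
(* The other end of [t] is on the left: reverse the word and rotate [h] back to the end. The
   reversed core [p b q a t b s a p] has the same shape with [a], [b] and [s], [q] exchanged. *)
have eq_rev x y : interlaced (rcons Q h) x y = interlaced (rcons (rev Q) h) x y.
  by rewrite interlaced_rcons -interlaced_rev rev_cons.
have pQ : perm_eq (rcons Q h) (rcons (rev Q) h).
  by rewrite -!cats1 perm_cat2r perm_sym perm_rev.
apply: (twins_avoiding_eq (W := rcons (rev Q) h)) => [x y||];
  [by rewrite eq_rev | by rewrite perm_sym | ].
have defQ : Q = L ++ [:: p; a; s; b; t; a; q; b; p] ++ R'.
  by move: defW; rewrite defR -!rcons_cat => /rcons_inj[].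
have tL' : t \in rev L by rewrite mem_rev.
case/splitPr def_revL: {-}_ / tL' => [L1 L2].
apply: (via_core _ (rev R') p b q a t s L1 (rcons L2 h)).
- exact: pointed_cubic_eq pcW.
- by rewrite size_rcons size_rev.
- by rewrite defQ !rev_cat def_revL -cats1 -!catA /= -?catA cats1.
- by rewrite last_rcons.
Qed.

(** * From letters to vertices *)

Lemma neighbors_image (T : finType) (e : rel T) W (f : T -> nat) v :
  double_occurrence W -> injective f -> (forall a, a \in W -> exists x, f x = a) ->
  (forall x y, e x y = interlaced W (f x) (f y)) ->
  size (neighbors W (f v)) = #|[set w | e v w]|.
Proof.
move=> dW injf surf eW; rewrite cardE -(size_map f); apply/perm_size/uniq_perm.
- exact: uniq_neighbors.
- by rewrite map_inj_uniq ?enum_uniq.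
move=> y; rewrite mem_neighbors; apply/idP/mapP => [vy | [x]]; last first.
  by rewrite mem_enum inE eW => vx ->.
by have [x fx] := surf _ (interlaced_mem vy); exists x; rewrite // mem_enum inE eW fx.
Qed.

(** A word for the graph can be rotated to end with the letter of [v]; the twin letters found there
    are then carried back along [f]. *)
Lemma twins_avoiding_vertex (T : finType) (e : rel T) (v : T) :
  simple_graph e -> cubic e -> circle_graph e ->
  exists u1 u2, [/\ u1 != v, u2 != v & twins e u1 u2].
Proof.
move=> [_ irr_e] cub_e [W [f [dW injf fW surf eW]]].
have degW x : x \in W -> size (neighbors W x) = 3.
  by move=> /surf[y <-]; rewrite (neighbors_image y dW injf surf eW) cub_e.
have [A [B defW]] : exists A B, W = A ++ f v :: B.
  by case/splitPr: (fW v) => A B; exists A, B.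
have eqW x y : interlaced W x y = interlaced (rcons (B ++ A) (f v)) x y.
  by rewrite defW interlaced_rcons interlaced_catC.
have pW : perm_eq W (rcons (B ++ A) (f v)).
  by rewrite defW perm_sym perm_rcons -cat_cons perm_catC.
have pcW : pointed_cubic W (f v) by split=> // [x xW _|]; rewrite degW.
have fullW : has (predC1 (f v)) (B ++ A).
  have := degW _ (fW v); case nbv: (neighbors W (f v)) => [|y s] // _.
  have vy : interlaced W (f v) y by rewrite -mem_neighbors nbv mem_head.
  have yv : y != f v by case/andP: vy; rewrite eq_sym.
  have := interlaced_mem vy; rewrite (perm_mem pW) mem_rcons inE (negbTE yv) => yBA.
  by apply/hasP; exists y.
have [u [w [uW wW uv wv tw]]] :=
  twins_avoiding_point (pointed_cubic_eq eqW pW pcW) fullW.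
rewrite -!(perm_mem pW) in uW wW.
have [u1 fu] := surf _ uW; have [u2 fw] := surf _ wW; subst u w.
exists u1, u2; split; [by apply: contraNneq uv => -> | by apply: contraNneq wv => -> |].
case: tw => u12 tw; split=> [|x xu1 xu2]; first by apply: contraNneq u12 => ->.
by rewrite !eW !eqW tw ?inj_eq.
Qed.

(** * Two disjoint pairs of twins *)

Lemma card3_set (T : finType) (A : {set T}) x y z :
  #|A| = 3 -> uniq [:: x; y; z] -> x \in A -> y \in A -> z \in A ->
  A = [set x; y; z].
Proof.
move=> A3 u xA yA zA; apply/esym/eqP; rewrite eqEcard A3; apply/andP; split.
  by apply/subsetP => t; rewrite !inE => /orP[/orP[] |] /eqP->.
by rewrite -setUA !cardsU1 cards1 !inE; move: u; rewrite /= !inE => /and3P[-> -> _].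
Qed.

Lemma cubic_neighbors (T : finType) (e : rel T) v x y z u : cubic e ->
  uniq [:: x; y; z] -> e v x -> e v y -> e v z -> e v u = (u \in [:: x; y; z]).
Proof.
move=> cub_e xyz vx vy vz.
have /setP/(_ u) : [set w | e v w] = [set x; y; z].
  by apply: card3_set; rewrite ?cub_e ?inE.
by rewrite !inE orbA.
Qed.

Lemma twinsC (T : finType) (e : rel T) u v : twins e u v -> twins e v u.
Proof. by case=> uv tw; split=> [|x xv xu]; [rewrite eq_sym | rewrite tw]. Qed.

(** If the triple is a triangle, the third neighbor [t] of [a] completes it to K_4, and [t], [a] are
    twins disjoint from [b], [c]. Otherwise each neighbor of [a] has neighborhood [a], [b], [c], so
    any two of them are twins. *)
Lemma two_twin_pairs_of_triple (T : finType) (e : rel T) (a b c : T) :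
  simple_graph e -> cubic e -> twins e a b -> twins e b c -> twins e a c ->
  exists v1 v2 w1 w2 : T,
    uniq [:: v1; v2; w1; w2] /\ twins e v1 v2 /\ twins e w1 w2.
Proof.
move=> [sym_e irr_e] cub_e [ab tab] [bc tbc] [ac tac].
have abc : uniq [:: a; b; c] by rewrite /= !inE negb_or ab ac bc.
have e_neq x y : e x y -> x != y by apply: contraTneq => ->; rewrite irr_e.
(* With [e_bc], this makes the triple pairwise adjacent or pairwise nonadjacent. *)
have e_ca : e c a = e b a by rewrite tbc.
have e_bc : e b c = e a c by rewrite tab // eq_sym.
have pick (A : {set T}) (v : T) : #|A| < 3 -> exists2 t, e v t & t \notin A.
  move=> A3; have /subsetPn[t] : ~~ ([set w | e v w] \subset A).
    by apply: contraL A3 => /subset_leq_card; rewrite cub_e -leqNgt.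
  by rewrite inE; exists t.
have nbr x : e a x -> x != b -> x != c -> x != a /\ forall y, e x y = (y \in [:: a; b; c]).
  move=> ax xb xc; have xa : x != a by rewrite eq_sym e_neq.
  split=> // y; apply: cubic_neighbors; rewrite // sym_e //.
    by rewrite -tab.
  by rewrite -tac.
have [e_ab | ne_ab] := boolP (e a b).
  have e_ac : e a c by rewrite sym_e e_ca sym_e.
  have [|t e_at] := pick [set b; c] a; first by rewrite cards2; case: (b != c).
  rewrite !inE negb_or => /andP[tb tc]; have [ta Nt] := nbr _ e_at tb tc.
  exists t, a, b, c; split; first by rewrite /= !inE !negb_or ta tb tc ab ac bc.
  split; last by split.
  split=> // x xt xa; rewrite Nt (@cubic_neighbors _ _ a b c t x) //.
    by rewrite !inE (negbTE xa) (negbTE xt) orbF.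
  by rewrite /= !inE negb_or bc !(eq_sym _ t) tb tc.
have ne_ac : ~~ e a c by rewrite sym_e e_ca sym_e.
have nb x : e a x -> x != b by apply: contraTneq => ->.
have nc x : e a x -> x != c by apply: contraTneq => ->.
have [|p ap _] := pick set0 a; first by rewrite cards0.
have [|q aq] := pick [set p] a; first by rewrite cards1.
rewrite inE => qp.
have [pa Np] := nbr _ ap (nb _ ap) (nc _ ap).
have [qa Nq] := nbr _ aq (nb _ aq) (nc _ aq).
exists p, q, a, b; split.
  by rewrite /= !inE !negb_or eq_sym qp pa qa nb // nb // ab.
by split; split=> // [|x _ _]; rewrite ?Np ?Nq // eq_sym.
Qed.

Theorem theorem2 (T : finType) (e : rel T) :
  simple_graph e -> 0 < #|T| -> cubic e -> circle_graph e ->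
  exists v1 v2 w1 w2 : T,
    uniq [:: v1; v2; w1; w2] /\ twins e v1 v2 /\ twins e w1 w2.
Proof.
move=> simple_e /card_gt0P[v0 _] cub_e circ_e.
have avoid := twins_avoiding_vertex _ simple_e cub_e circ_e.
have [u1 [u2 [_ _ tu]]] := avoid v0.
have disjoint_pairs x1 x2 y1 y2 : twins e x1 x2 -> twins e y1 y2 ->
    y1 != x1 -> y2 != x1 -> y1 != x2 -> y2 != x2 ->
    exists v1 v2 w1 w2 : T,
      uniq [:: v1; v2; w1; w2] /\ twins e v1 v2 /\ twins e w1 w2.
  move=> tx ty n11 n21 n12 n22; exists x1, x2, y1, y2; split=> //.
  by rewrite /= !inE !negb_or (proj1 tx) (proj1 ty) !(eq_sym x1) !(eq_sym x2)
    n11 n21 n12 n22.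
(* A pair avoiding [u2] is disjoint from [u1], [u2] or from [u2], [w], unless it consists of [u1]
   and [w]; then [u1], [u2], [w] are pairwise twins. *)
have chain w : w != u1 -> twins e u2 w -> exists v1 v2 w1 w2 : T,
    uniq [:: v1; v2; w1; w2] /\ twins e v1 v2 /\ twins e w1 w2.
  move=> wu1 tw; have [y [z [yu2 zu2 tyz]]] := avoid u2.
  have [yu1 | yu1] := eqVneq y u1; have [zu1 | zu1] := eqVneq z u1.
  - by case: tyz; rewrite yu1 zu1 eqxx.
  - have [zw | zw] := eqVneq z w.
      by apply: (two_twin_pairs_of_triple simple_e cub_e tu tw); rewrite -yu1 -zw.
    by apply: (disjoint_pairs u2 w y z) => //; rewrite yu1 eq_sym.
  - have [yw | yw] := eqVneq y w.
      apply: (two_twin_pairs_of_triple simple_e cub_e tu tw).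
      by apply: twinsC; rewrite -zu1 -yw.
    by apply: (disjoint_pairs u2 w y z) => //; rewrite zu1 eq_sym.
  - exact: (disjoint_pairs u1 u2 y z).
(* This pair avoids [u1], so it can meet the first pair only in [u2], and then [chain] applies. *)
have [w1 [w2 [w1u1 w2u1 tw]]] := avoid u1.
have [w1u2 | w1u2] := eqVneq w1 u2.
  by apply: (chain w2) => //; rewrite -w1u2.
have [w2u2 | w2u2] := eqVneq w2 u2.
  by apply: (chain w1) => //; rewrite -w2u2; apply: twinsC.
exact: (disjoint_pairs u1 u2 w1 w2).
Qed.
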